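(* Let $S$ be a finite groupoid with parity structure, let $1\leftarrow X\xrightarrow{p}S$ be a $\mathbb P$-span from $\mathsf e$ to $S$ with $2$-cell $\epsilon$, and let $s\in S$. Consider the composite of this $\mathbb P$-span with the $\mathbb P$-span $S\xleftarrow{\ulcorner s\urcorner}1\to 1$ (with trivial $2$-cell); it is a scalar $\widehat X_s$ whose underlying groupoid is the homotopy fibre $X_s$. If $s$ has an odd automorphism, then the scalar $\widehat X_s$ has cardinality zero.
   Context: Let $O(1)=\{+1,-1\}$ and let $\mathbb P=BO(1)$ be the one-object groupoid with automorphism group $O(1)$. All groupoids are finite (finitely many isomorphism classes, finite hom sets), and pullbacks and fibres are homotopy ones. A parity structure on a groupoid $S$ is a functor $S\to\mathbb P$; it assigns to each arrow $a$ a parity $\mathrm{par}(a)\in\{\pm1\}$ (even $=+1$, odd $=-1$), multiplicatively. $\mathsf e:1\to\mathbb P$ is the unique parity structure on the terminal groupoid. $\ulcorner s\urcorner:1\to S$ is the functor picking out $s$. A $\mathbb P$-span from $f:S\to\mathbb P$ to $g:T\to\mathbb P$ is a span of groupoids $S\xleftarrow{p}M\xrightarrow{q}T$ with a natural isomorphism $\rho:f p\Rightarrow g q$, i.e. signs $\rho_x\in\{\pm1\}$ with $\mathrm{par}(p(a))\,\rho_{x'}=\rho_x\,\mathrm{par}(q(a))$ for each $a:x\to x'$ in $M$. Composition is by homotopy pullback, with the sign of an object $(m,a:q(m)\to p'(n),n)$ of the pullback being $\rho_m\cdot\mathrm{par}(a)\cdot\rho'_n$. A scalar is a $\mathbb P$-span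 from $\mathsf e$ to $\mathsf e$; its groupoid splits by sign as $S=S_\oplus\sqcup S_\ominus$. In the composite of the statement, objects of $X_s$ are pairs $(x,a:p(x)\to s)$, with sign $\epsilon_x\cdot\mathrm{par}(a)$. The cardinality of a finite groupoid is $|S|=\sum_{s\in\pi_0S}1/|\mathrm{Aut}(s)|$, and the cardinality of a scalar $\widehat S$ is $|\widehat S|=|S_\oplus|-|S_\ominus|\in\mathbb Q$. *)

(* Defs.v *)
From mathcomp Require Import all_boot all_order all_algebra generic_quotient.
From mathcomp Require Import boolp classical_sets functions cardinality fsbigop.
Set Implicit Arguments.
Unset Strict Implicit.
Unset Printing Implicit Defensive.
Import GRing.Theory Num.Theory.

Local Open Scope classical_set_scope.
Local Open Scope quotient_scope.

(* Composition is written in diagrammatic order. *)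
Record groupoid := Groupoid {
  obj :> Type;
  arrow : obj -> obj -> finType;
  idt : forall x, arrow x x;
  cmp : forall x y z, arrow x y -> arrow y z -> arrow x z;
  ginv : forall x y, arrow x y -> arrow y x;
  cmpA : forall x y z t (a : arrow x y) (b : arrow y z) (c : arrow z t),
    cmp a (cmp b c) = cmp (cmp a b) c;
  cmp1g : forall x y (a : arrow x y), cmp (idt x) a = a;
  cmpg1 : forall x y (a : arrow x y), cmp a (idt y) = a;
  cmpgV : forall x y (a : arrow x y), cmp a (ginv a) = idt x;
  cmpVg : forall x y (a : arrow x y), cmp (ginv a) a = idt y }.

Arguments idt {_} x.
Arguments ginv {_ _ _} a.

Declare Scope groupoid_scope.
Delimit Scope groupoid_scope with grpd.
Local Open Scope groupoid_scope.
Notation "a ;; b" := (cmp a b) (at level 50, left associativity)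
  : groupoid_scope.

Section Pi0.
Variable G : groupoid.

(* Objects form an arbitrary type; {classic _} equips it with the choice
   structure that quotients require. *)
Definition iso (x y : {classic obj G}) : bool := 0 < #|@arrow G x y|.

Lemma isoP (x y : {classic obj G}) : iso x y <-> inhabited (@arrow G x y).
Proof.
by split=> [/card_gt0P[a _]|[a]]; [exists|apply/card_gt0P; exists a].
Qed.

Lemma iso_refl : reflexive iso.
Proof. by move=> x; apply/isoP; exists; exact: (@idt G x). Qed.

Lemma iso_sym : symmetric iso.
Proof.
suff imp x y : iso x y -> iso y x by move=> x y; apply/idP/idP; exact: imp.
by move=> /isoP[a]; apply/isoP; exists; exact: (ginv a).
Qed.

Lemma iso_trans : transitive iso.
Proof.
move=> y x z /isoP[a] /isoP[b]; apply/isoP; exists; exact: (a ;; b).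
Qed.

Definition iso_equiv := EquivRel iso iso_refl iso_sym iso_trans.

Definition pi0 := {eq_quot iso_equiv}.

Lemma pi0_eqP (x y : {classic obj G}) :
  (\pi_pi0 x = \pi_pi0 y)%qT <-> inhabited (@arrow G x y).
Proof. by rewrite -isoP; split=> [/eqmodP|xy]; [|apply/eqmodP]. Qed.

Lemma pi0_finiteP :
  finite_set [set: pi0] <->
  exists (I : finType) (r : I -> G), forall x, exists i, inhabited (arrow x (r i)).
Proof.
split=> [/finite_seqP[s sE]|[I [r rP]]].
  exists 'I_(size s), (fun i => (repr (tnth (in_tuple s) i) : {classic obj G})).
  move=> x; have : [set: pi0] (\pi_pi0 x)%qT by [].
  rewrite sE /= => /(tnthP (in_tuple s))[i ri]; exists i.
  by apply/pi0_eqP; rewrite reprK ri.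
apply: (@sub_finite_set _ _ [set (\pi_pi0 (r i : {classic obj G}))%qT | i in [set: I]]).
  move=> c _; have [i xi] := rP (repr c : {classic obj G}).
  by exists i => //; move/pi0_eqP: xi => <-; rewrite reprK.
exact: finite_image.
Qed.

End Pi0.

Record finGroupoid := FinGroupoid {
  fin_base :> groupoid;
  fin_pi0 : finite_set [set: pi0 fin_base] }.

Local Open Scope ring_scope.

(* [repr c] is a chosen representative of the isomorphism class [c]. *)
Definition gcard (G : finGroupoid) : rat :=
  \sum_(c \in [set: pi0 G])
    (#|arrow (repr c : {classic obj G}) (repr c : {classic obj G})|%:R : rat)^-1.

Local Close Scope ring_scope.

Record functor (G H : groupoid) := Functor {
  fobj :> G -> H;
  fmap : forall x y, arrow x y -> arrow (fobj x) (fobj y);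
  fmap1 : forall x, fmap (idt x) = idt (fobj x);
  fmapM : forall x y z (a : arrow x y) (b : arrow y z),
    fmap (a ;; b) = fmap a ;; fmap b }.

Arguments fmap {_ _} _ {_ _} _.

Lemma fmapV (G H : groupoid) (F : functor G H) x y (a : arrow x y) :
  fmap F (ginv a) = ginv (fmap F a).
Proof.
rewrite -[LHS]cmpg1 -(cmpgV (fmap F a)) cmpA -fmapM cmpVg fmap1.
exact: cmp1g.
Qed.

Definition id_functor (G : groupoid) : functor G G :=
  @Functor G G id (fun _ _ a => a) (fun=> erefl) (fun _ _ _ _ _ => erefl).

Section CompFunctor.
Variables (G H K : groupoid) (F : functor G H) (E : functor H K).
Let cmap x y (a : arrow x y) : arrow (E (F x)) (E (F y)) := fmap E (fmap F a).
Fact comp_functor1 x : cmap (idt x) = idt _.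
Proof. by rewrite /cmap !fmap1. Qed.
Fact comp_functorM x y z (a : arrow x y) (b : arrow y z) :
  cmap (a ;; b) = cmap a ;; cmap b.
Proof. by rewrite /cmap !fmapM. Qed.
Definition comp_functor : functor G K := Functor comp_functor1 comp_functorM.
End CompFunctor.

Lemma paste (K : groupoid) (x0 x1 x2 x3 y0 y1 y2 y3 : K)
    (a0 : arrow x0 y0) (a1 : arrow x1 y1) (a2 : arrow x2 y2) (a3 : arrow x3 y3)
    (b1 : arrow x0 x1) (b2 : arrow x1 x2) (b3 : arrow x2 x3)
    (c1 : arrow y0 y1) (c2 : arrow y1 y2) (c3 : arrow y2 y3) :
  a0 ;; c1 = b1 ;; a1 -> a1 ;; c2 = b2 ;; a2 -> a2 ;; c3 = b3 ;; a3 ->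
  a0 ;; (c1 ;; c2 ;; c3) = b1 ;; b2 ;; b3 ;; a3.
Proof.
by move=> E1 E2 E3; rewrite !cmpA E1 -(cmpA b1) E2 cmpA -(cmpA _ a2) E3 cmpA.
Qed.

(* Every natural transformation between functors to a groupoid is invertible. *)
Record natiso (G H : groupoid) (F E : functor G H) := NatIso {
  cell :> forall x, arrow (F x) (E x);
  cell_nat : forall x y (a : arrow x y), fmap F a ;; cell y = cell x ;; fmap E a }.

Fact one_pi0_subproof (G : groupoid) (x0 : G) :
  (forall x, inhabited (arrow x x0)) -> finite_set [set: pi0 G].
Proof. by move=> x0P; apply/pi0_finiteP; exists unit, (fun=> x0) => x; exists tt. Qed.

Definition one_base : groupoid.
Proof.
refine (@Groupoid unit (fun _ _ => unit : finType) (fun=> tt)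
  (fun _ _ _ _ _ => tt) (fun _ _ _ => tt) _ _ _ _ _); by do ?case.
Defined.

Definition one_grpd : finGroupoid :=
  FinGroupoid (@one_pi0_subproof one_base tt (fun=> inhabits tt)).

(* O(1) = {+1, -1} is represented by [bool] under [addb]: [b] stands for
   (-1)^b, so that [true] is odd. *)
Definition BO1_base : groupoid.
Proof.
refine (@Groupoid unit (fun _ _ => bool : finType) (fun=> false)
  (fun _ _ _ => addb) (fun _ _ => id) _ _ _ _ _); by do ?case.
Defined.

Definition BO1 : finGroupoid :=
  FinGroupoid (@one_pi0_subproof BO1_base tt (fun=> inhabits false)).

Notation parity_structure S := (functor S BO1).

Definition par (S : groupoid) (f : parity_structure S) (x y : S) (a : arrow x y) :
  bool := fmap f a.

Definition odd_arrow (S : groupoid) (f : parity_structure S) (x y : S)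
  (a : arrow x y) : Prop := par f a = true.

Section Name.
Variables (S : groupoid) (s : S).
Fact name1 (x : one_grpd) : idt s = idt s. Proof. by []. Qed.
Fact nameM (x y z : one_grpd) (a : arrow x y) (b : arrow y z) :
  idt s = idt s ;; idt s.
Proof. by rewrite cmp1g. Qed.
Definition name : functor one_grpd S :=
  @Functor one_grpd S (fun=> s) (fun _ _ _ => idt s) name1 nameM.
End Name.

Definition e_par : parity_structure one_grpd := name (tt : BO1).

Section HPullback.
Variables (M N T : finGroupoid) (q : functor M T) (p : functor N T).

Record hpb_obj := HpbObj {
  hpb_l : M; hpb_r : N; hpb_a : arrow (q hpb_l) (p hpb_r) }.

Implicit Types x y z t : hpb_obj.

Definition hpb_hom x y : finType :=
  {uv : arrow (hpb_l x) (hpb_l y) * arrow (hpb_r x) (hpb_r y) |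
    fmap q uv.1 ;; hpb_a y == hpb_a x ;; fmap p uv.2}.

Fact hpb_id_subproof x :
  fmap q (idt (hpb_l x)) ;; hpb_a x == hpb_a x ;; fmap p (idt (hpb_r x)).
Proof. by rewrite !fmap1 cmp1g cmpg1. Qed.

Definition hpb_id x : hpb_hom x x :=
  exist _ (idt (hpb_l x), idt (hpb_r x)) (hpb_id_subproof x).

Fact hpb_cmp_subproof x y z (a : hpb_hom x y) (b : hpb_hom y z) :
  fmap q ((val a).1 ;; (val b).1) ;; hpb_a z ==
  hpb_a x ;; fmap p ((val a).2 ;; (val b).2).
Proof.
rewrite !fmapM -cmpA; have /eqP-> := valP b.
by rewrite !cmpA; have /eqP-> := valP a.
Qed.

Definition hpb_cmp x y z (a : hpb_hom x y) (b : hpb_hom y z) : hpb_hom x z :=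
  exist _ ((val a).1 ;; (val b).1, (val a).2 ;; (val b).2)
    (hpb_cmp_subproof a b).

Fact hpb_inv_subproof x y (a : hpb_hom x y) :
  fmap q (ginv (val a).1) ;; hpb_a x == hpb_a y ;; fmap p (ginv (val a).2).
Proof.
rewrite !fmapV -[X in X == _]cmpg1 -(cmpgV (fmap p (val a).2)) -cmpA.
rewrite [X in _ ;; X]cmpA; have /eqP <- := valP a.
by rewrite !cmpA cmpVg cmp1g.
Qed.

Definition hpb_inv x y (a : hpb_hom x y) : hpb_hom y x :=
  exist _ (ginv (val a).1, ginv (val a).2) (hpb_inv_subproof a).

Fact hpb_cmpA x y z t (a : hpb_hom x y) (b : hpb_hom y z) (c : hpb_hom z t) :
  hpb_cmp a (hpb_cmp b c) = hpb_cmp (hpb_cmp a b) c.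
Proof. by apply: val_inj; rewrite /= !cmpA. Qed.
Fact hpb_cmp1g x y (a : hpb_hom x y) : hpb_cmp (hpb_id x) a = a.
Proof. by apply: val_inj; rewrite /= !cmp1g -surjective_pairing. Qed.
Fact hpb_cmpg1 x y (a : hpb_hom x y) : hpb_cmp a (hpb_id y) = a.
Proof. by apply: val_inj; rewrite /= !cmpg1 -surjective_pairing. Qed.
Fact hpb_cmpgV x y (a : hpb_hom x y) : hpb_cmp a (hpb_inv a) = hpb_id x.
Proof. by apply: val_inj; rewrite /= !cmpgV. Qed.
Fact hpb_cmpVg x y (a : hpb_hom x y) : hpb_cmp (hpb_inv a) a = hpb_id y.
Proof. by apply: val_inj; rewrite /= !cmpVg. Qed.

Definition hpullback_base : groupoid :=
  Groupoid hpb_cmpA hpb_cmp1g hpb_cmpg1 hpb_cmpgV hpb_cmpVg.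

Fact hpullback_fin : finite_set [set: pi0 hpullback_base].
Proof.
have /pi0_finiteP[I [r rP]] := fin_pi0 M.
have /pi0_finiteP[J [k kP]] := fin_pi0 N.
apply/pi0_finiteP.
exists {ij : I * J & arrow (q (r ij.1)) (p (k ij.2))}, (fun w => HpbObj (tagged w)).
move=> [m n a]; have [i [u]] := rP m; have [j [v]] := kP n.
pose b : arrow (q (r (i, j).1)) (p (k (i, j).2)) :=
  ginv (fmap q u) ;; a ;; fmap p v.
exists (Tagged (fun ij : I * J => arrow (q (r ij.1)) (p (k ij.2))) b).
have uvP : fmap q u ;; b == a ;; fmap p v.
  by rewrite /b !cmpA cmpgV cmp1g.
by exists; exists (u, v).
Qed.

Definition hpullback : finGroupoid := FinGroupoid hpullback_fin.

Definition hpb_fst : functor hpullback M :=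
  @Functor hpullback M hpb_l (fun x y a => (val a).1)
    (fun=> erefl) (fun _ _ _ _ _ => erefl).
Definition hpb_snd : functor hpullback N :=
  @Functor hpullback N hpb_r (fun x y a => (val a).2)
    (fun=> erefl) (fun _ _ _ _ _ => erefl).

End HPullback.

Definition hfibre (X S : finGroupoid) (p : functor X S) (s : S) : finGroupoid :=
  hpullback p (name s).

Section FullSub.
Variables (G : finGroupoid) (P : pred G).
Let sub := {x : G | P x}.

Definition fullsub_base : groupoid.
Proof.
refine (@Groupoid sub (fun x y => arrow (sval x) (sval y)) (fun x => idt (sval x))
  (fun _ _ _ a b => a ;; b) (fun _ _ a => ginv a) _ _ _ _ _) => *.
- exact: cmpA.
- exact: cmp1g.
- exact: cmpg1.
- exact: cmpgV.
- exact: cmpVg.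
Defined.

Fact fullsub_fin : finite_set [set: pi0 fullsub_base].
Proof.
have /pi0_finiteP[I [r rP]] := fin_pi0 G; apply/pi0_finiteP.
pose D i := exists x : sub, inhabited (arrow (sval x) (r i)).
have DP (i : {i : I | `[< D i >]}) : D (val i) by exact/asboolP/(valP i).
exists {i : I | `[< D i >]}, (fun i => sval (cid (DP i))) => x.
have [i xi] := rP (sval x).
have Di : `[< D i >] by apply/asboolP; exists x.
exists (exist _ i Di); case: cid => /= y [b]; case: xi => a.
by exists; exact: (a ;; ginv b).
Qed.

Definition fullsub : finGroupoid := FinGroupoid fullsub_fin.
End FullSub.

Record pspan (S T : finGroupoid) (f : parity_structure S)
    (g : parity_structure T) := PSpan {
  apex : finGroupoid;
  lleg : functor apex S;
  rleg : functor apex T;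
  rho : natiso (comp_functor lleg f) (comp_functor rleg g) }.

Section PComp.
Variables (S T U : finGroupoid) (f : parity_structure S)
  (g : parity_structure T) (h : parity_structure U)
  (M : pspan f g) (N : pspan g h).

Let pb := hpullback (rleg M) (lleg N).
Let L : functor pb S := comp_functor (hpb_fst _ _) (lleg M).
Let R : functor pb U := comp_functor (hpb_snd _ _) (rleg N).

Definition pcomp_cell (x : pb) : arrow (comp_functor L f x) (comp_functor R h x) :=
  rho M (hpb_l x) ;; fmap g (hpb_a x) ;; rho N (hpb_r x).

Fact pcomp_nat x y (a : arrow x y) :
  fmap (comp_functor L f) a ;; pcomp_cell y =
  pcomp_cell x ;; fmap (comp_functor R h) a.
Proof.
have sq : fmap g (fmap (rleg M) (val a).1) ;; fmap g (hpb_a y) =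
    fmap g (hpb_a x) ;; fmap g (fmap (lleg N) (val a).2).
  by rewrite -!fmapM; have /eqP-> := valP a.
exact: paste (cell_nat (rho M) (val a).1) sq (cell_nat (rho N) (val a).2).
Qed.

Definition pcomp : pspan f h := PSpan (NatIso pcomp_nat).
End PComp.

Notation scalar := (pspan e_par e_par).

Definition scalar_sign (Z : scalar) (x : apex Z) : bool := rho Z x.
Definition scalar_even (Z : scalar) : finGroupoid :=
  fullsub (fun x : apex Z => ~~ scalar_sign x).
Definition scalar_odd (Z : scalar) : finGroupoid :=
  fullsub (fun x : apex Z => scalar_sign x).

Definition scalar_card (Z : scalar) : rat :=
  (gcard (scalar_even Z) - gcard (scalar_odd Z))%R.

Section NameSpan.
Variables (S : finGroupoid) (f : parity_structure S) (s : S).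
Let L := comp_functor (name s) f.
Let R := comp_functor (id_functor one_grpd) e_par.
(* The trivial 2-cell: all signs are +1, and all hom sets of BO(1) are the
   same type. *)
Definition name_cell (x : one_grpd) : arrow (L x) (R x) := false.
Fact name_nat (x y : one_grpd) (a : arrow x y) :
  fmap L a ;; name_cell y = name_cell x ;; fmap R a.
Proof. by rewrite /= fmap1. Qed.
Definition name_span : pspan f e_par := PSpan (NatIso name_nat).
End NameSpan.

Definition scalar_at (S : finGroupoid) (f : parity_structure S)
  (X : pspan e_par f) (s : S) : scalar := pcomp X (name_span f s).

Lemma scalar_at_sign (S : finGroupoid) (f : parity_structure S)
    (X : pspan e_par f) (s : S) (x : hfibre (rleg X) s) :
  @scalar_sign (scalar_at X s) x = rho X (hpb_l x) (+) par f (hpb_a x).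
Proof. exact: addbF. Qed.

(* Main.v *)
(* Composing with an odd automorphism [u] of [s], [(x, a) |-> (x, a ;; u)],
   reverses the sign of every object of the homotopy fibre and preserves all
   hom sets, so it is an equivalence between the odd and the even part. *)

Require Import Defs.
From mathcomp Require Import all_boot all_order all_algebra.
From mathcomp Require Import generic_quotient.
From mathcomp Require Import boolp classical_sets functions cardinality fsbigop.
Set Implicit Arguments.
Unset Strict Implicit.
Unset Printing Implicit Defensive.
Local Open Scope groupoid_scope.
Local Open Scope quotient_scope.
Local Open Scope classical_set_scope.

Lemma cmp_injl (G : groupoid) (x y z : G) (a : arrow x y) :
  injective (fun b : arrow y z => a ;; b).
Proof.
by move=> b c E; rewrite -(cmp1g b) -(cmp1g c) -(cmpVg a) -!cmpA E.
Qed.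

Lemma cmp_injr (G : groupoid) (x y z : G) (a : arrow y z) :
  injective (fun b : arrow x y => b ;; a).
Proof.
by move=> b c E; rewrite -(cmpg1 b) -(cmpg1 c) -(cmpgV a) !cmpA E.
Qed.

(** Conjugation by [a] is injective; conjugating by [ginv a] will give the reverse inequality. *)
Lemma leq_card_aut (G : groupoid) (x y : G) (a : arrow x y) :
  #|arrow x x| <= #|arrow y y|.
Proof.
by apply: (leq_card (fun b => ginv a ;; b ;; a)) => b c /cmp_injr/cmp_injl.
Qed.

Lemma card_aut (G : groupoid) (x y : G) :
  inhabited (arrow x y) -> #|arrow x x| = #|arrow y y|.
Proof.
by case=> a; apply/eqP; rewrite eqn_leq !(leq_card_aut a, leq_card_aut (ginv a)).
Qed.

(* The cardinality only sees the sizes of hom sets, hence a plain map [F]. *)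
Lemma gcard_eq (G H : finGroupoid) (F : G -> H) :
  (forall x y, #|arrow x y| = #|arrow (F x) (F y)|) ->
  (forall y, exists x, inhabited (arrow (F x) y)) ->
  gcard G = gcard H.
Proof.
move=> Fhom Fsurj.
(* Hom sets of equal size are nonempty together, so [F] preserves and reflects isomorphism although
   it has no action on arrows. *)
have Finh x y : inhabited (arrow (F x) (F y)) <-> inhabited (arrow x y).
  by rewrite -[X in X <-> _]isoP -[X in _ <-> X]isoP /iso Fhom.
pose rp (K : groupoid) (c : pi0 K) : K := repr c.
pose phi (c : pi0 G) : pi0 H := \pi_(pi0 H) (F (rp G c) : {classic obj H}).
have phi_bij : set_bij [set: pi0 G] [set: pi0 H] phi.
  split => //.
    move=> c d _ _ /pi0_eqP/Finh/(pi0_eqP (G := G) (rp G c) (rp G d)).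
    by rewrite /rp !reprK.
  move=> d _; have [x /(pi0_eqP (G := H) (F x) (rp H d)) xd] := Fsurj (rp H d).
  exists (\pi_(pi0 G) (x : {classic obj G})) => //.
  rewrite /rp reprK in xd; rewrite -xd; apply/pi0_eqP/Finh/pi0_eqP.
  by rewrite /rp reprK.
rewrite /gcard (reindex_fsbig _ _ _ _ phi_bij).
apply: eq_fsbigr => c _; congr (_ %:R^-1)%R.
(* The chosen representative of [phi c] is only isomorphic to [F (rp G c)], which suffices for
   automorphism groups of equal size. *)
rewrite (Fhom (rp G c) (rp G c)); apply: card_aut.
by apply/pi0_eqP; rewrite reprK.
Qed.

Section OddAutomorphism.
Variables (S : finGroupoid) (f : parity_structure S) (X : pspan e_par f).
Variables (s : S) (u : arrow s s).
Hypothesis u_odd : odd_arrow f u.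

Definition hfibre_shift (x : hfibre (rleg X) s) : hfibre (rleg X) s :=
  @HpbObj _ _ _ (rleg X) (name s) (hpb_l x) (hpb_r x) (hpb_a x ;; u).

(** Both hom sets consist of the same pairs: the compatibility condition after the shift is the
    original one composed with [u] on the right, and [u] cancels. *)
Lemma card_arrow_shift (x y : hfibre (rleg X) s) :
  #|arrow x y| = #|arrow (hfibre_shift x) (hfibre_shift y)|.
Proof.
rewrite !card_sig; apply: eq_card => v; rewrite !inE /= !cmpg1 cmpA.
by rewrite (inj_eq (@cmp_injr _ _ _ _ u)).
Qed.

Lemma scalar_sign_shift (x : apex (scalar_at X s)) :
  @scalar_sign (scalar_at X s) (hfibre_shift x)
    = ~~ @scalar_sign (scalar_at X s) x.
Proof.
rewrite !scalar_at_sign /par /= fmapM /= -[fmap f u]/(par f u) u_odd.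
by rewrite addbA addbT.
Qed.

Lemma shift_even (x : scalar_odd (scalar_at X s)) :
  ~~ @scalar_sign (scalar_at X s) (hfibre_shift (sval x)).
Proof. by rewrite scalar_sign_shift negbK (svalP x). Qed.

Lemma scalar_card_odd : scalar_card (scalar_at X s) = 0%R.
Proof.
apply/eqP; rewrite GRing.subr_eq0 eq_sym; apply/eqP.
pose F (x : scalar_odd (scalar_at X s)) : scalar_even (scalar_at X s) :=
  exist _ (hfibre_shift (sval x)) (shift_even x).
apply: (@gcard_eq _ _ F) => [x y|[[m n b] yP]]; first exact: card_arrow_shift.
(* Essential surjectivity: undoing the shift with [ginv u] gives a strict preimage in the fibre, odd
   because its shift is even. *)
pose x : hfibre (rleg X) s :=
  @HpbObj _ _ _ (rleg X) (name s) m n (b ;; ginv u).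
have xE : hfibre_shift x = HpbObj b.
  by rewrite /hfibre_shift /= -cmpA cmpVg cmpg1.
have xP : @scalar_sign (scalar_at X s) x.
  by rewrite -[scalar_sign _]negbK -scalar_sign_shift xE.
exists (exist _ x xP).
(* [xE] is an equation in the fibre, so it is rewritten there, away from the sign proofs; arrows of
   the even part are arrows of the fibre. *)
have [i] : inhabited (arrow (hfibre_shift x) (HpbObj b)).
  by rewrite xE; constructor; exact: idt.
by constructor; exact: i.
Qed.

End OddAutomorphism.

Theorem lemma3p2p1 (S : finGroupoid) (f : parity_structure S)
    (X : pspan e_par f) (s : S) :
  apex (scalar_at X s) = hfibre (rleg X) s /\
  ((exists a : arrow s s, odd_arrow f a) -> scalar_card (scalar_at X s) = 0%R).
Proof. by split=> // -[u u_odd]; exact: scalar_card_odd u_odd. Qed.
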